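(* Let $G$ be a finitely generated left-orderable group acting co-finitely, minimally and with general type on a simplicial tree $T$, with all vertex stabilizers finitely generated. Let $v$ be a vertex of $T$, let $\mathcal{P}=\{G_e: e\in\mathrm{link}_T(v)\}$, and let $H\in\mathcal{P}$. Assume that the vertex stabilizer $G_v$ is Hucha with respect to $H$ and that every group in $\mathcal{P}$ is Prieto. Then $G$ is Hucha with respect to the family consisting of all cyclic subgroups of $G$ and all subgroups of $G$ acting elliptically on $T$.
   Context: Actions on trees are without edge inversions. $G_v$, $G_e$ denote stabilizers of a vertex, an edge; $\mathrm{link}_T(v)$ is the set of edges adjacent to $v$. Co-finite: finitely many orbits of vertices and edges. Minimal: $T$ is the only $G$-invariant subtree. General type: $G$ fixes no vertex and no end of $T$ and the orbit of a vertex meets at least three ends (ends are classes of rays with infinite intersection; $G$ fixes an end if some ray $p$ has $gp\cap p$ infinite for all $g$). A subgroup acts elliptically if it fixes a vertex. A positive cone of a group $K$ is a subsemigroup $P$ with $K=P\sqcup P^{-1}\sqcup\{1\}$. For a finite generating set $X$ with word metric $d_X$, an $r$-path is a sequence $g_0,\dots,g_n$ with $d_X(g_i,g_{i+1})\le r$; a subset is coarsely connected if for some $r$ any two of its points are joined by an $r$-path inside it. $S$ $r$-disconnects $H_1,H_2$ if every $r$-path from $H_1$ to $H_2$ meets $S$, and $r$-disconnects $P$ if it $r$-disconnects $\{u\},\{v\}$ for some $u,v\in P$. A negative swamp of width $r$ for a subgroup $L$ is $S\subseteq P^{-1}$ that $r$-disconnects $P$ and $r$-disconnects $g_1L,g_2L$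 for some $g_1,g_2$. A finitely generated left-orderable group $K$ is Hucha with respect to a family $\mathcal{H}$ (resp. a subgroup $L$, meaning $\mathcal{H}=\{L\}$) if for some (equivalently any) finite generating set, for every positive cone $P$, every member of $\mathcal{H}$ and every $r>0$ there is a negative swamp of width $r$ for it. $K$ is Prieto if it is finitely generated, left-orderable and all its positive cones are coarsely connected. *)

(* Defs.v *)
From Stdlib Require Import List Arith ZArith.
Import ListNotations.
Set Implicit Arguments.

Record group := Group {
  gcar :> Type;
  gmul : gcar -> gcar -> gcar;
  gone : gcar;
  ginv : gcar -> gcar;
  gmulA : forall x y z, gmul x (gmul y z) = gmul (gmul x y) z;
  gmul1l : forall x, gmul gone x = x;
  gmul1r : forall x, gmul x gone = x;
  gmulVl : forall x, gmul (ginv x) x = gone;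
  gmulVr : forall x, gmul x (ginv x) = gone }.

Section Groups.
Variable G : group.
Notation mul := (@gmul G).
Notation inv := (@ginv G).
Notation one := (@gone G).

Definition whole : G -> Prop := fun _ => True.

Definition is_subgroup (K : G -> Prop) : Prop :=
  K one /\ (forall x y, K x -> K y -> K (mul x y)) /\ (forall x, K x -> K (inv x)).

Fixpoint gpow_nat (g : G) (n : nat) : G :=
  match n with O => one | S k => mul g (gpow_nat g k) end.
Definition gpowZ (g : G) (z : Z) : G :=
  match z with
  | Z0 => one
  | Zpos p => gpow_nat g (Pos.to_nat p)
  | Zneg p => inv (gpow_nat g (Pos.to_nat p))
  end.

Definition cyclic_subgroup (L : G -> Prop) : Prop :=
  exists g : G, forall x, L x <-> exists n : Z, x = gpowZ g n.

Definition letter (X : list G) (a : G) : Prop := In a X \/ In (inv a) X.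
Definition prod (w : list G) : G := fold_right mul one w.

Definition gen_set (X : list G) (K : G -> Prop) : Prop :=
  (forall x, In x X -> K x) /\
  (forall k, K k <-> exists w, Forall (letter X) w /\ prod w = k).

Definition fin_gen (K : G -> Prop) : Prop := exists X, gen_set X K.

Definition dist_le (X : list G) (r : nat) (g h : G) : Prop :=
  exists w, Forall (letter X) w /\ length w <= r /\ prod w = mul (inv g) h.

Definition left_orderable (K : G -> Prop) : Prop :=
  exists lt : G -> G -> Prop,
    (forall a, ~ lt a a) /\
    (forall a b c, lt a b -> lt b c -> lt a c) /\
    (forall a b, K a -> K b -> a <> b -> lt a b \/ lt b a) /\
    (forall g a b, K g -> K a -> K b -> lt a b -> lt (mul g a) (mul g b)).

Definition positive_cone (K P : G -> Prop) : Prop :=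
  (forall x, P x -> K x) /\
  (forall x y, P x -> P y -> P (mul x y)) /\
  (forall k, K k -> P k \/ P (inv k) \/ k = one) /\
  (forall k, ~ (P k /\ P (inv k))) /\
  ~ P one.

Fixpoint rpath_tail (X : list G) (r : nat) (x : G) (l : list G) : Prop :=
  match l with
  | [] => True
  | y :: l' => dist_le X r x y /\ rpath_tail X r y l'
  end.
Definition rpath (K : G -> Prop) (X : list G) (r : nat) (x0 : G) (l : list G) : Prop :=
  Forall K (x0 :: l) /\ rpath_tail X r x0 l.

Definition coarsely_connected (K : G -> Prop) (X : list G) (P : G -> Prop) : Prop :=
  exists r : nat, forall u w, P u -> P w ->
    exists l, rpath K X r u l /\ Forall P l /\ last (u :: l) u = w.

Definition r_disconnects (K : G -> Prop) (X : list G) (r : nat)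
  (S A B : G -> Prop) : Prop :=
  forall x0 l, rpath K X r x0 l -> A x0 -> B (last (x0 :: l) x0) ->
    exists y, In y (x0 :: l) /\ S y.

Definition r_disconnects_set (K : G -> Prop) (X : list G) (r : nat)
  (S P : G -> Prop) : Prop :=
  exists u w, P u /\ P w /\ r_disconnects K X r S (eq u) (eq w).

Definition coset (g : G) (L : G -> Prop) : G -> Prop :=
  fun x => exists l, L l /\ x = mul g l.

Definition negative_swamp (K : G -> Prop) (X : list G) (P L : G -> Prop)
  (r : nat) (S : G -> Prop) : Prop :=
  (forall s, S s -> P (inv s)) /\
  r_disconnects_set K X r S P /\
  exists g1 g2, K g1 /\ K g2 /\ r_disconnects K X r S (coset g1 L) (coset g2 L).

Definition Hucha (K : G -> Prop) (F : (G -> Prop) -> Prop) : Prop :=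
  left_orderable K /\
  exists X, gen_set X K /\
    forall P, positive_cone K P ->
    forall L, F L ->
    forall r : nat, 0 < r -> exists S, negative_swamp K X P L r S.

Definition Hucha_sub (K L : G -> Prop) : Prop := Hucha K (fun L' => L' = L).

Definition Prieto (K : G -> Prop) : Prop :=
  left_orderable K /\
  exists X, gen_set X K /\
    forall P, positive_cone K P -> coarsely_connected K X P.

End Groups.

Section Trees.
Variable V : Type.
Variable adj : V -> V -> Prop.

Fixpoint walk (l : list V) : Prop :=
  match l with
  | x :: ((y :: _) as t) => adj x y /\ walk t
  | _ => True
  end.

Fixpoint no_backtrack (l : list V) : Prop :=
  match l with
  | x :: ((_ :: z :: _) as t) => x <> z /\ no_backtrack t
  | _ => True
  end.

Definition is_tree : Prop :=
  (forall a b, adj a b -> adj b a) /\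
  (forall a, ~ adj a a) /\
  (forall a b, exists l, walk (a :: l) /\ last (a :: l) a = b) /\
  (forall a l, l <> [] -> walk (a :: l) -> no_backtrack (a :: l) ->
     last (a :: l) a <> a).

(* c lies on the geodesic from a to b *)
Definition between (a c b : V) : Prop :=
  forall l, walk (a :: l) -> last (a :: l) a = b -> In c (a :: l).

Definition finite_set (A : V -> Prop) : Prop :=
  exists l, forall x, A x -> In x l.

Definition ray (p : nat -> V) : Prop :=
  (forall n, adj (p n) (p (S n))) /\ (forall n, p (S (S n)) <> p n).

Definition equiv_rays (p q : nat -> V) : Prop :=
  ~ finite_set (fun x => (exists n, p n = x) /\ (exists m, q m = x)).
End Trees.

Section Actions.
Variable G : group.
Variable V : Type.
Variable adj : V -> V -> Prop.
Variable act : G -> V -> V.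

Definition tree_action : Prop :=
  (forall x, act (gone G) x = x) /\
  (forall g h x, act (@gmul G g h) x = act g (act h x)) /\
  (forall g a b, adj a b -> adj (act g a) (act g b)).

Definition without_inversions : Prop :=
  forall g a b, adj a b -> ~ (act g a = b /\ act g b = a).

Definition stab (u : V) : G -> Prop := fun g => act g u = u.

Definition edge_stab (a b : V) : G -> Prop :=
  fun g => (act g a = a /\ act g b = b) \/ (act g a = b /\ act g b = a).

Definition cofinite : Prop :=
  (exists vs : list V, forall u, exists a g, In a vs /\ act g a = u) /\
  (exists es : list (V * V), (forall e, In e es -> adj (fst e) (snd e)) /\
     forall a b, adj a b -> exists e g, In e es /\
       ((act g (fst e) = a /\ act g (snd e) = b) \/
        (act g (fst e) = b /\ act g (snd e) = a))).

Definition minimal_action : Prop :=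
  forall S : V -> Prop,
    (exists u, S u) ->
    (forall g u, S u -> S (act g u)) ->
    (forall a b, S a -> S b ->
       exists l, @walk V adj (a :: l) /\ Forall S l /\ last (a :: l) a = b) ->
    forall u, S u.

Definition fixes_end : Prop :=
  exists p, @ray V adj p /\
    forall g, ~ finite_set (fun x => (exists n, act g (p n) = x) /\ (exists m, p m = x)).

(* the end represented by the ray p is met by (is a limit of) the orbit of x *)
Definition orbit_meets_end (x : V) (p : nat -> V) : Prop :=
  forall n, exists g, @between V adj (p 0) (p n) (act g x).

Definition general_type : Prop :=
  (~ exists u, forall g, act g u = u) /\
  ~ fixes_end /\
  exists x p1 p2 p3,
    @ray V adj p1 /\ @ray V adj p2 /\ @ray V adj p3 /\
    orbit_meets_end x p1 /\ orbit_meets_end x p2 /\ orbit_meets_end x p3 /\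
    ~ @equiv_rays V p1 p2 /\ ~ @equiv_rays V p1 p3 /\ ~ @equiv_rays V p2 p3.

Definition elliptic (L : G -> Prop) : Prop :=
  exists u, forall g, L g -> act g u = u.
End Actions.

(* Main.v *)
(* A negative swamp may always be taken to be the whole negative cone, so everything is about
   the complement [{x : 1 <= x}] of [P^-1], or after translation about [{x : c <= x}]. Let [w] be
   the neighbour of [v] with [H = G_v /\ G_w]. An r-path of [G], followed through a fixed orbit
   map, is a walk in the tree; each passage of this walk through an edge at [v] leaves a trace in
   [G_v] at bounded distance. For [c] large, traces of a path in [{x : c <= x}] lie in the
   nonnegative part of [G_v] for the cone [G_v /\ c P c^-1]. Two consecutive traces belong either
   to one visit of [v], and are then close, or to the two ends of an excursion through one edge,
   and are then in one coset of an edge group, where they are joined inside the nonnegative part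
   because edge groups are Prieto. So a path between the branches at [g1 w] and [g2 w] would give a
   path in [G_v] from [g1 H] to [g2 H], which the Hucha property of [G_v] forbids.

   If no translate of the branch [B] at [w] contained the complement of [B], then the complements
   of the translates of [B] would intersect pairwise and define an invariant subtree or a fixed
   end. Hence some flip exists; it gives positive elements in both branches, and translates every
   bounded orbit deep into them. For a cyclic group generated by [h >= 1] the nonnegative part of
   [u L] is connected to [u], so disconnecting the points [u1], [u2] disconnects [u1 L], [u2 L]. *)
Require Import Defs.
From Stdlib Require Import List Arith ZArith.
From Stdlib Require Import Lia Relations Classical ClassicalEpsilon.
From Stdlib Require Import FunctionalExtensionality PropExtensionality.
Import ListNotations.

(** * Branches of a tree *)

Lemma last_default {A} (l : list A) a d d' : last (a :: l) d = last (a :: l) d'.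
Proof. revert a; induction l as [|b l IH]; intros a; [reflexivity|exact (IH b)]. Qed.

Lemma last_cons2 {A} (l : list A) a b : last (a :: b :: l) a = last (b :: l) b.
Proof. exact (last_default l b a b). Qed.

Section Branches.
Variable V : Type.
Variable adj : V -> V -> Prop.
Hypothesis hT : is_tree adj.

Definition off (x a b : V) : Prop := adj a b /\ a <> x /\ b <> x.

(** The component of [y] after removal of the vertex [x]; for adjacent [x] and [y] this is the
    half-tree on the side of [y]. *)
Definition branch (x y u : V) : Prop :=
  adj x y /\ clos_refl_trans V (off x) y u.

Lemma adj_sym a b : adj a b -> adj b a.
Proof. apply hT. Qed.

Lemma adj_neq a b : adj a b -> a <> b.
Proof. intros h e; subst; exact (proj1 (proj2 hT) _ h). Qed.

Lemma walk_tail a l : walk adj (a :: l) -> walk adj l.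
Proof. destruct l; [easy|intros [_ h]; exact h]. Qed.

Lemma no_backtrack_tail (a : V) l : no_backtrack (a :: l) -> no_backtrack l.
Proof. destruct l as [|b [|c l]]; try easy; intros [_ h]; exact h. Qed.

Lemma walk_snoc a l x :
  walk adj (a :: l) -> adj (last (a :: l) a) x -> walk adj (a :: l ++ [x]).
Proof.
revert a; induction l as [|b l IH]; intros a hw hx; [split; easy|].
rewrite last_cons2 in hx; destruct hw as [hab hw].
split; [exact hab|exact (IH b hw hx)].
Qed.

Lemma no_backtrack_snoc (l : list V) x :
  Forall (fun z => z <> x) l -> no_backtrack l -> no_backtrack (l ++ [x]).
Proof.
induction l as [|a [|b l] IH]; intros hf hn; [easy|easy|].
pose proof (Forall_inv hf) as ha; pose proof (Forall_inv_tail hf) as hf'.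
specialize (IH hf' (no_backtrack_tail _ _ hn)).
destruct l as [|c l]; [split; easy|].
split; [exact (proj1 hn)|exact IH].
Qed.

(** Induction along the walk: a first step that the next one undoes is deleted together with its
    reversal. *)
Lemma off_reduced x y y' : y <> x -> clos_refl_trans V (off x) y y' ->
  exists l, walk adj (y :: l) /\ no_backtrack (y :: l) /\ last (y :: l) y = y' /\
    Forall (fun z => z <> x) (y :: l).
Proof.
intros hy h; apply clos_rt_rt1n in h; revert hy.
induction h as [y|y z y' [hyz [_ hz]] h IH]; intros hy.
- exists []; repeat split; auto.
- destruct (IH hz) as [l [hw [hn [hl hf]]]].
  assert (hcase : (exists l', l = y :: l') \/ no_backtrack (y :: z :: l)).
  { destruct l as [|c l']; [right; split; easy|].
    destruct (classic (c = y)) as [->|hc]; [left; now exists l'|].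
    right; split; [congruence|exact hn]. }
  destruct hcase as [[l' ->]|hn'].
  + exists l'; split; [exact (walk_tail _ _ hw)|].
    split; [exact (no_backtrack_tail _ _ hn)|].
    split; [rewrite <- hl; symmetry; apply last_cons2|exact (Forall_inv_tail hf)].
  + exists (z :: l); split; [split; assumption|].
    split; [exact hn'|]; split; [now rewrite last_cons2|].
    constructor; assumption.
Qed.

(** Otherwise a reduced walk from [y] to [y'] off [x], closed up through [x] at both ends, would be
    a reduced closed walk. *)
Lemma off_neighbors_eq x y y' :
  adj x y -> adj x y' -> clos_refl_trans V (off x) y y' -> y = y'.
Proof.
intros hy hy' h.
assert (hyx : y <> x) by (intros e; symmetry in e; exact (adj_neq _ _ hy e)).
destruct (off_reduced x y y' hyx h) as [l [hw [hn [hl hf]]]].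
destruct l as [|z l]; [exact hl|exfalso].
apply (proj2 (proj2 (proj2 hT)) x ((y :: z :: l) ++ [x])).
- easy.
- split; [exact hy|].
  apply (walk_snoc y (z :: l) x hw); rewrite hl; now apply adj_sym.
- pose proof (no_backtrack_snoc _ _ hf hn) as hs.
  split; [|exact hs].
  pose proof (Forall_inv (Forall_inv_tail hf)) as hz; simpl in hz; congruence.
- change (x :: (y :: z :: l) ++ [x]) with ((x :: y :: z :: l) ++ [x]).
  apply last_last.
Qed.

Lemma branch_adj x y u : branch x y u -> adj x y.
Proof. now intros [h _]. Qed.

Lemma branch_self x y : adj x y -> branch x y y.
Proof. intros h; split; [exact h|apply rt_refl]. Qed.

Lemma branch_neq x y u : branch x y u -> u <> x.
Proof.
intros [h hc]; apply clos_rt_rtn1 in hc.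
destruct hc as [|z u [_ [_ hz]] _]; [|exact hz].
intros e; symmetry in e; exact (adj_neq _ _ h e).
Qed.

Lemma branch_step x y u u' : branch x y u -> adj u u' -> u' <> x -> branch x y u'.
Proof.
intros h ha hn; split; [exact (proj1 h)|].
apply rt_trans with u; [exact (proj2 h)|apply rt_step].
split; [exact ha|split; [exact (branch_neq _ _ _ h)|exact hn]].
Qed.

Lemma off_sym x a b : clos_refl_trans V (off x) a b -> clos_refl_trans V (off x) b a.
Proof.
induction 1 as [a b [h1 [h2 h3]]|a|a b c _ IH1 _ IH2].
- apply rt_step; split; [now apply adj_sym|split; assumption].
- apply rt_refl.
- now apply rt_trans with b.
Qed.

Lemma branch_unique x y y' u : branch x y u -> branch x y' u -> y = y'.
Proof.
intros [h c] [h' c']; apply (off_neighbors_eq x); auto.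
apply rt_trans with u; [exact c|now apply off_sym].
Qed.

Lemma tree_connected a b : clos_refl_trans V adj a b.
Proof.
destruct (proj1 (proj2 (proj2 hT)) a b) as [l [hw hl]].
revert a hw hl; induction l as [|c l IH]; intros a hw hl.
- simpl in hl; subst; apply rt_refl.
- apply rt_trans with c; [apply rt_step, hw|].
  apply IH; [exact (walk_tail _ _ hw)|now rewrite last_cons2 in hl].
Qed.

Lemma branch_exists x u : u <> x -> exists y, branch x y u.
Proof.
pose proof (tree_connected x u) as h; apply clos_rt_rtn1 in h.
induction h as [|u' u hu _ IH]; intros hn; [easy|].
destruct (classic (u' = x)) as [->|hx].
- exists u; now apply branch_self.
- destruct (IH hx) as [y hy]; exists y; now apply branch_step with u'.
Qed.

Lemma branch_cover x y u : adj x y -> branch x y u \/ branch y x u.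
Proof.
intros hxy; pose proof (tree_connected x u) as h; apply clos_rt_rtn1 in h.
induction h as [|u' u hu _ [IH|IH]].
- right; now apply branch_self, adj_sym.
- destruct (classic (u = x)) as [->|hn].
  + right; now apply branch_self, adj_sym.
  + left; now apply branch_step with u'.
- destruct (classic (u = y)) as [->|hn].
  + left; now apply branch_self.
  + right; now apply branch_step with u'.
Qed.

Lemma branch_disjoint x y u : branch x y u -> branch y x u -> False.
Proof.
intros h [hyx hc]; revert h; apply clos_rt_rtn1 in hc.
induction hc as [|u' u [hu [hu'y huy]] _ IH]; intros h.
- exact (branch_neq _ _ _ h eq_refl).
- destruct (classic (u' = x)) as [->|hn].
  + apply huy; apply (branch_unique x _ _ u); [now apply branch_self|exact h].
  + apply IH; apply branch_step with u; auto; now apply adj_sym.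
Qed.

(** Adjacent vertices other than [x] share a branch at [x], so a branch is entered only through its
    base edge. *)
Lemma branch_crossing x y a b :
  adj a b -> branch x y b -> ~ branch x y a -> a = x /\ b = y.
Proof.
intros hab hb ha.
destruct (classic (a = x)) as [->|hn].
- split; [easy|]. apply (branch_unique x _ _ b); [now apply branch_self|exact hb].
- exfalso; apply ha; apply branch_step with b; auto; now apply adj_sym.
Qed.

(** The walk can leave the branch only through [x]. The remainder after that visit is strictly
    shorter, as an induction on length requires. *)
Lemma exit_suffix x y s l :
  walk adj (s :: l) -> branch x y s -> ~ branch x y (last (s :: l) s) ->
  exists l', length l' < length l /\ walk adj (x :: l') /\
    last (x :: l') x = last (s :: l) s.
Proof.
revert s; induction l as [|t l IH]; intros s hw hs hl; [easy|].
rewrite last_cons2 in hl |- *.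
destruct (classic (t = x)) as [->|ht].
- exists l; split; [simpl; lia|split; [exact (proj2 hw)|reflexivity]].
- destruct (IH t (proj2 hw)) as [l' [h1 [h2 h3]]]; auto.
  + apply branch_step with s; auto; apply hw.
  + exists l'; simpl; auto with arith.
Qed.

(* Cutting a walk at each excursion out of the intersection makes it stay inside. *)
Lemma walk_in_intersection (F : V -> V -> Prop) (S : V -> Prop)
  (hS : forall u, S u <-> forall x y, F x y -> ~ branch x y u) l a b :
  S a -> S b -> walk adj (a :: l) -> last (a :: l) a = b ->
  exists l', walk adj (a :: l') /\ Forall S l' /\ last (a :: l') a = b.
Proof.
remember (length l) as n eqn:hn; revert l a hn.
induction n as [n IH] using (well_founded_induction lt_wf).
intros [|s l] a hn ha hb hw hl; [exists []; auto|].
rewrite last_cons2 in hl.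
destruct (classic (S s)) as [hs|hs].
- simpl in hn.
  destruct (IH (length l) ltac:(lia) l s eq_refl hs hb (proj2 hw) hl) as [l' [h1 [h2 h3]]].
  exists (s :: l'); split; [split; [apply hw|exact h1]|].
  split; [constructor; assumption|now rewrite last_cons2].
- rewrite hS in hs; apply not_all_ex_not in hs as [x hs].
  apply not_all_ex_not in hs as [y hs].
  apply imply_to_and in hs as [hF hs]; apply NNPP in hs.
  destruct (branch_crossing x y a s (proj1 hw) hs) as [-> ->].
  { now apply hS. }
  destruct (exit_suffix x y y l (proj2 hw) hs) as [l' [h1 [h2 h3]]].
  { rewrite hl; now apply hS. }
  simpl in hn.
  apply (IH (length l') ltac:(lia) l'); auto; congruence.
Qed.

(** * Rays in a tree *)

Lemma ray_walk p i k : ray adj p ->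
  walk adj (map p (seq i k)) /\ no_backtrack (map p (seq i k)).
Proof.
intros [h1 h2]; revert i; induction k as [|k IH]; intros i; [easy|].
destruct k as [|k]; [easy|]; specialize (IH (S i)); destruct IH as [w n].
split; [split; [apply h1|exact w]|].
destruct k as [|k]; [easy|].
split; [intros e; exact (h2 i (eq_sym e))|exact n].
Qed.

(** The segment between two visits of one vertex would be a reduced closed walk. *)
Lemma ray_injective p i j : ray adj p -> i < j -> p i <> p j.
Proof.
intros hp hij e.
destruct (ray_walk p i (S (j - i)) hp) as [w n].
apply (proj2 (proj2 (proj2 hT)) (p i) (map p (seq (S i) (j - i)))); auto.
- replace (j - i) with (S (j - i - 1)) by lia; easy.
- change (p i :: map p (seq (S i) (j - i))) with (map p (seq i (S (j - i)))).
  rewrite seq_S, map_app; simpl map; rewrite last_last.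
  replace (i + (j - i)) with j by lia; auto.
Qed.

Lemma ray_tail_infinite p m (A : V -> Prop) :
  ray adj p -> (forall k, A (p (m + k))) -> ~ finite_set A.
Proof.
intros hp hA [l hl].
assert (hnd : NoDup (map p (seq m (S (length l))))).
{ apply (NoDup_map_NoDup_ForallPairs p); [|apply seq_NoDup].
  intros a b _ _ e.
  destruct (lt_eq_lt_dec a b) as [[h|h]|h]; auto.
  - destruct (ray_injective p a b hp h e).
  - destruct (ray_injective p b a hp h (eq_sym e)). }
assert (hi : incl (map p (seq m (S (length l)))) l).
{ intros z hz; apply in_map_iff in hz as [n [<- hn]]; apply in_seq in hn.
  apply hl; replace n with (m + (n - m)) by lia; apply hA. }
pose proof (NoDup_incl_length hnd hi) as hlen.
rewrite length_map, length_seq in hlen; lia.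
Qed.

End Branches.

(** * Flipping a branch *)

Section GroupFacts.
Variable G : group.
Local Notation "x ** y" := (gmul G x y) (at level 40, left associativity).
Local Notation inv := (ginv G).
Local Notation one := (gone G).

Lemma mul_assoc x y z : (x ** y) ** z = x ** (y ** z).
Proof. symmetry; apply gmulA. Qed.

Lemma inv_mul_cancel x y : inv x ** (x ** y) = y.
Proof. now rewrite gmulA, gmulVl, gmul1l. Qed.

Lemma mul_inv_cancel x y : x ** (inv x ** y) = y.
Proof. now rewrite gmulA, gmulVr, gmul1l. Qed.

Lemma mul_cancel_l x y z : x ** y = x ** z -> y = z.
Proof. intros h; now rewrite <- (inv_mul_cancel x y), h, inv_mul_cancel. Qed.

Lemma inv_inv x : inv (inv x) = x.
Proof. apply (mul_cancel_l (inv x)); now rewrite gmulVr, gmulVl. Qed.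

Lemma inv_one : inv one = one.
Proof. apply (mul_cancel_l one); now rewrite gmulVr, gmul1l. Qed.

Lemma inv_mul x y : inv (x ** y) = inv y ** inv x.
Proof.
apply (mul_cancel_l (x ** y)).
now rewrite gmulVr, mul_assoc, mul_inv_cancel, gmulVr.
Qed.
End GroupFacts.

#[local] Hint Rewrite mul_assoc gmul1l gmul1r gmulVl gmulVr inv_mul_cancel
  mul_inv_cancel inv_inv inv_one inv_mul : grp.
Ltac gsimpl := autorewrite with grp.

(** * Translates of branches under the group *)

Section ActionOnTree.
Variables (G : group) (V : Type) (adj : V -> V -> Prop) (act : G -> V -> V).
Local Notation "x ** y" := (gmul G x y) (at level 40, left associativity).
Local Notation inv := (ginv G).
Local Notation one := (gone G).
Local Notation Br := (branch V adj).
Hypothesis hT : is_tree adj.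
Hypothesis hA : tree_action G adj act.

Lemma act_one x : act one x = x.
Proof. apply hA. Qed.

Lemma act_mul g h x : act (g ** h) x = act g (act h x).
Proof. apply hA. Qed.

Lemma act_adj g a b : adj a b -> adj (act g a) (act g b).
Proof. apply hA. Qed.

Lemma act_inv g x : act (inv g) (act g x) = x.
Proof. now rewrite <- act_mul, gmulVl, act_one. Qed.

Lemma act_inv_r g x : act g (act (inv g) x) = x.
Proof. now rewrite <- act_mul, gmulVr, act_one. Qed.

Lemma act_injective g a b : act g a = act g b -> a = b.
Proof. intros e; now rewrite <- (act_inv g a), e, act_inv. Qed.

Lemma act_branch g x y u : Br x y u -> Br (act g x) (act g y) (act g u).
Proof.
intros [h c]; split; [now apply act_adj|]; clear h.
induction c as [a b [h1 [h2 h3]]|a|a b c _ IH1 _ IH2].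
- apply rt_step; split; [now apply act_adj|].
  split; intros e; apply act_injective in e; auto.
- apply rt_refl.
- now apply rt_trans with (act g b).
Qed.

Lemma act_branch_iff g x y u : Br (act g x) (act g y) (act g u) <-> Br x y u.
Proof.
split; [|apply act_branch].
intros h; apply (act_branch (inv g)) in h; now rewrite !act_inv in h.
Qed.

Lemma act_branch_inv g x y u : Br (act g x) (act g y) u <-> Br x y (act (inv g) u).
Proof. now rewrite <- (act_branch_iff g x y), act_inv_r. Qed.

(** The complement of the branch at [a] is connected, contains [a] and misses [x], so it lies in a
    single branch at [x]. *)
Lemma branch_far_side a b x y u :
  Br a b x -> Br x y a -> ~ Br a b u -> Br x y u.
Proof.
intros hx hy hu.
pose proof (branch_adj _ _ _ _ _ hx) as hab.
destruct (branch_cover _ _ hT a b u hab) as [h|[_ h]]; [easy|].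
assert (hside : forall z, clos_refl_trans V (off V adj b) a z -> z <> x).
{ intros z hz ->; apply (branch_disjoint _ _ hT a b x hx).
  split; [now apply (adj_sym _ _ hT)|exact hz]. }
clear hu; apply clos_rt_rtn1 in h; induction h as [|u' u hs h IH]; [exact hy|].
apply (branch_step _ _ hT) with u'; [exact IH|apply hs|].
apply hside; apply clos_rtn1_rt; now apply Relation_Operators.rtn1_trans with u'.
Qed.

Variables v w : V.
Hypothesis hvw : adj v w.
Local Notation tbr h := (Br (act h v) (act h w)).

(** * The end that is fixed when no flip exists *)

Section NoFlip.
Hypothesis hno : forall h h', exists u, ~ tbr h u /\ ~ tbr h' u.

(* [y] is the neighbour of [x] in the direction of the end cut out by the
   complements of the translates of the branch. *)
Definition toward x y := exists h, tbr h x /\ Br x y (act h v).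

(** Each complement lies wholly beyond its neighbour of [x], and the two complements meet. *)
Lemma toward_unique x y y' : toward x y -> toward x y' -> y = y'.
Proof.
intros [h [h1 h2]] [h' [h1' h2']].
destruct (hno h h') as [u [hu hu']].
apply (branch_unique _ _ hT x y y' u).
- exact (branch_far_side _ _ _ _ _ h1 h2 hu).
- exact (branch_far_side _ _ _ _ _ h1' h2' hu').
Qed.

(** A common point of the two complements would lie on both sides of the edge. *)
Lemma toward_no_return x y : toward x y -> ~ toward y x.
Proof.
intros [h [h1 h2]] [h' [h1' h2']].
destruct (hno h h') as [u [hu hu']].
apply (branch_disjoint _ _ hT x y u).
- exact (branch_far_side _ _ _ _ _ h1 h2 hu).
- exact (branch_far_side _ _ _ _ _ h1' h2' hu').
Qed.

Lemma toward_act g x y : toward x y -> toward (act g x) (act g y).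
Proof.
intros [h [h1 h2]]; exists (g ** h); rewrite !act_mul.
split; now apply act_branch.
Qed.

(** If [z] is not [y], the complement lies beyond [z]; hence [y] is in the translated branch too and
    sees the complement through [x]. *)
Lemma toward_adjacent x y z : adj x y -> toward x z -> z = y \/ toward y x.
Proof.
intros hxy [h [h1 h2]].
destruct (classic (z = y)) as [e|hn]; [now left|right; exists h].
assert (hy : tbr h y).
{ apply NNPP; intros hy; apply hn.
  apply (branch_unique _ _ hT x _ _ y).
  - exact (branch_far_side _ _ _ _ _ h1 h2 hy).
  - now apply branch_self. }
split; [exact hy|].
destruct (branch_cover _ _ hT x y (act h v) hxy) as [h3|h3]; [|exact h3].
destruct hn; exact (branch_unique _ _ hT _ _ _ _ h2 h3).
Qed.

(** A vertex outside all translates would make the intersection of the complements a nonempty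
    invariant subtree. By minimality it would be everything, yet [w] lies in the branch. *)
Lemma toward_exists x : minimal_action G adj act -> exists y, toward x y.
Proof.
intros hmin.
assert (hc : exists h, tbr h x).
{ apply NNPP; intros hx.
  pose (S := fun u => forall h, ~ tbr h u).
  assert (hS : S w).
  { apply hmin.
    - exists x; intros h hh; apply hx; now exists h.
    - intros g u hu h hh; apply (hu (inv g ** h)).
      rewrite !act_mul; apply act_branch_iff with g; now rewrite !act_inv_r.
    - intros a b ha hb.
      destruct (proj1 (proj2 (proj2 hT)) a b) as [l [hw hl]].
      apply (walk_in_intersection _ _ hT
        (fun p q => exists h, p = act h v /\ q = act h w) S) with l; auto.
      intros u; split.
      + intros hu p q [h [-> ->]]; apply hu.
      + intros hu h; apply hu; now exists h. }
  apply (hS one); rewrite !act_one; now apply branch_self. }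
destruct hc as [h hh].
destruct (branch_exists _ _ hT x (act h v)) as [y hy].
- intros e; apply (branch_neq _ _ hT _ _ _ hh); auto.
- exists y, h; auto.
Qed.

(** Iterating the map to the next vertex gives a ray. This map is equivariant and any two of its
    orbits merge, so every translate of the ray shares a tail with it. *)
Lemma no_flip_fixes_end : minimal_action G adj act -> fixes_end G adj act.
Proof.
intros hmin.
pose (phi := fun x => proj1_sig (constructive_indefinite_description _
  (toward_exists x hmin))).
assert (hphi : forall x, toward x (phi x)).
{ intros x; exact (proj2_sig (constructive_indefinite_description _
    (toward_exists x hmin))). }
clearbody phi.
assert (hequiv : forall n g x, Nat.iter n phi (act g x) = act g (Nat.iter n phi x)).
{ induction n as [|n IH]; intros g x; [reflexivity|simpl; rewrite IH].
  apply (toward_unique (act g (Nat.iter n phi x))); [apply hphi|].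
  apply toward_act, hphi. }
assert (hmerge : forall x y, exists a b, Nat.iter a phi x = Nat.iter b phi y).
{ intros x y; pose proof (tree_connected _ _ hT x y) as h.
  apply clos_rt_rt1n in h; induction h as [x|x z y hxz _ [a [b e]]]; [now exists 0, 0|].
  destruct (toward_adjacent x z (phi x) hxz (hphi x)) as [e1|e1].
  - exists (S a), b; rewrite <- e, Nat.iter_succ_r; now rewrite e1.
  - pose proof (toward_unique _ _ _ e1 (hphi z)) as e2.
    exists a, (S b); rewrite e2, <- Nat.iter_succ_r.
    now rewrite !Nat.iter_succ, e. }
exists (fun n => Nat.iter n phi v).
assert (hray : ray adj (fun n => Nat.iter n phi v)).
{ split; intros n; simpl.
  - destruct (hphi (Nat.iter n phi v)) as [h [_ h2]]; exact (branch_adj _ _ _ _ _ h2).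
  - intros e; apply (toward_no_return _ _ (hphi (Nat.iter n phi v))).
    rewrite <- e at 2; apply hphi. }
split; [exact hray|intros g].
destruct (hmerge (act g v) v) as [a [b e]].
apply (ray_tail_infinite _ _ hT (fun n => Nat.iter n phi v) b); [exact hray|].
intros k; split; [exists (k + a)|now exists (b + k)].
rewrite <- hequiv, Nat.iter_add, e, <- Nat.iter_add, Nat.add_comm; reflexivity.
Qed.
End NoFlip.

(** If the complements for [h] and [h'] are disjoint, then [inv h' ** h] is a flip. *)
Lemma exists_flip : minimal_action G adj act -> ~ fixes_end G adj act ->
  exists g, forall u, ~ Br v w u -> Br v w (act g u).
Proof.
intros hmin hend; apply NNPP; intros hn; apply hend.
apply no_flip_fixes_end; [|exact hmin].
intros h h'; apply NNPP; intros hu; apply hn.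
exists (inv h' ** h); intros u h1.
rewrite act_mul; apply act_branch_iff with h'; rewrite act_inv_r.
apply NNPP; intros h2; apply hu; exists (act h u); split; [|exact h2].
now rewrite act_branch_iff.
Qed.

End ActionOnTree.

(** * Word metrics and cones *)

Section WordMetric.
Variable G : group.
Local Notation "x ** y" := (gmul G x y) (at level 40, left associativity).
Local Notation inv := (ginv G).
Local Notation one := (gone G).

Lemma dist_le_mono X r r' g h : r <= r' -> dist_le G X r g h -> dist_le G X r' g h.
Proof. intros hr [w [h1 [h2 h3]]]; exists w; repeat split; auto; lia. Qed.

Lemma rpath_tail_mono X r r' x l :
  r <= r' -> rpath_tail G X r x l -> rpath_tail G X r' x l.
Proof.
intros hr; revert x; induction l as [|y l IH]; intros x h; [exact I|].
split; [apply dist_le_mono with r; [exact hr|apply h]|apply IH, h].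
Qed.

(** Bounded steps are recorded as finite lists of differences, so that groups with different
    generating sets can be compared. *)
Lemma ball_finite X r : exists L, forall g h, dist_le G X r g h -> In (inv g ** h) L.
Proof.
assert (hw : exists L, forall u, Forall (letter G X) u -> length u <= r -> In (prod G u) L).
{ induction r as [|r [L hL]].
  - exists [one]; intros [|a u] _ hl; [now left|simpl in hl; lia].
  - exists (one :: flat_map (fun a => map (gmul G a) L) (X ++ map inv X)).
    intros [|a u] hf hl; [now left|right; simpl in hl].
    apply in_flat_map; exists a; split.
    + apply in_or_app; destruct (Forall_inv hf) as [h|h]; [now left|right].
      rewrite <- (inv_inv _ a); now apply in_map.
    + apply (in_map (gmul G a)), hL; [exact (Forall_inv_tail hf)|lia]. }
destruct hw as [L hL]; exists L; intros g h [u [h1 [h2 h3]]]; rewrite <- h3; auto.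
Qed.

Lemma list_bounded_length X K M : gen_set G X K ->
  exists r, forall m, In m M -> K m -> forall g, dist_le G X r g (g ** m).
Proof.
intros [_ hX]; induction M as [|a M [r hr]]; [exists 0; easy|].
destruct (classic (K a)) as [ha|ha].
- apply hX in ha as [u [hu e]].
  exists (r + length u); intros m [<-|hm] hK g.
  + exists u; rewrite inv_mul_cancel; repeat split; auto; lia.
  + apply dist_le_mono with r; [lia|auto].
- exists r; intros m [<-|hm] hK g; [easy|auto].
Qed.

Lemma dist_le_translate X r a g h :
  dist_le G X r g h -> dist_le G X r (a ** g) (a ** h).
Proof. intros [u hu]; exists u; gsimpl; exact hu. Qed.

Lemma rpath_tail_translate X r a x l :
  rpath_tail G X r x l -> rpath_tail G X r (a ** x) (map (gmul G a) l).
Proof.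
revert x; induction l as [|y l IH]; intros x h; [exact I|].
split; [apply dist_le_translate, h|apply IH, h].
Qed.
End WordMetric.

Lemma last_map {A B} (f : A -> B) l a d d' :
  last (map f (a :: l)) d = f (last (a :: l) d').
Proof. revert a; induction l as [|b l IH]; intros a; [reflexivity|exact (IH b)]. Qed.

(** * The left-invariant order of a positive cone *)

Section Order.
Variable G : group.
Local Notation "x ** y" := (gmul G x y) (at level 40, left associativity).
Local Notation inv := (ginv G).
Local Notation one := (gone G).
Variable P : G -> Prop.
Hypothesis hP : positive_cone G (whole G) P.

Definition cone_lt a b := P (inv a ** b).
Definition cone_le a b := a = b \/ cone_lt a b.
Local Notation lt := cone_lt.
Local Notation le := cone_le.

Lemma lt_mul g a b : lt (g ** a) (g ** b) <-> lt a b.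
Proof. unfold cone_lt; gsimpl; reflexivity. Qed.

Lemma le_mul g a b : le (g ** a) (g ** b) <-> le a b.
Proof.
unfold cone_le; rewrite lt_mul; split; intros [h|h]; auto.
- left; exact (mul_cancel_l _ _ _ _ h).
- left; congruence.
Qed.

Lemma lt_trans a b c : lt a b -> lt b c -> lt a c.
Proof.
unfold cone_lt; intros h h'; pose proof (proj1 (proj2 hP) _ _ h h') as h2.
revert h2; gsimpl; auto.
Qed.

Lemma lt_irrefl a : ~ lt a a.
Proof. unfold cone_lt; rewrite gmulVl; apply hP. Qed.

Lemma lt_trichotomy a b : lt a b \/ lt b a \/ a = b.
Proof.
destruct (proj1 (proj2 (proj2 hP)) (inv a ** b) I) as [h|[h|h]]; [now left| |].
- right; left; revert h; unfold cone_lt; now gsimpl.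
- right; right; apply (mul_cancel_l _ (inv a)); now rewrite gmulVl.
Qed.

Lemma le_trans a b c : le a b -> le b c -> le a c.
Proof.
intros [->|h] [<-|h']; unfold cone_le; auto; right; exact (lt_trans _ _ _ h h').
Qed.

Lemma le_or_lt a b : le a b \/ lt b a.
Proof. destruct (lt_trichotomy a b) as [h|[h|h]]; unfold cone_le; auto. Qed.

Lemma le_not_lt a b : le a b -> ~ lt b a.
Proof.
intros [->|h] h'; [exact (lt_irrefl _ h')|exact (lt_irrefl _ (lt_trans _ _ _ h h'))].
Qed.

Lemma list_upper_bound l : exists c, forall x, In x l -> le x c.
Proof.
induction l as [|a l [c hc]]; [exists one; easy|].
destruct (le_or_lt a c) as [h|h].
- exists c; intros x [<-|hx]; auto.
- exists a; intros x [<-|hx]; [now left|].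
  apply le_trans with c; [auto|now right].
Qed.

(** The inequality says that [k] lies in the conjugate of [P] by [c]. *)
Lemma conjugate_cone K c : is_subgroup G K ->
  positive_cone G K (fun k => K k /\ lt c (k ** c)).
Proof.
intros [h1 [hm hi]]; split; [tauto|].
assert (hinv : forall k, lt c (inv k ** c) <-> lt (k ** c) c).
{ intros k; rewrite <- (lt_mul k); now gsimpl. }
split; [|split; [|split]].
- intros x y [kx hx] [ky hy]; split; [auto|].
  apply lt_trans with (x ** c); [exact hx|]; rewrite mul_assoc; now apply lt_mul.
- intros k hk; rewrite hinv.
  destruct (lt_trichotomy c (k ** c)) as [h|[h|h]]; auto.
  right; right; rewrite <- (gmul1r G k), <- (gmulVr G c), gmulA, <- h; reflexivity.
- intros k [[_ h] [_ h']]; apply hinv in h'.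
  exact (lt_irrefl _ (lt_trans _ _ _ h h')).
- intros [_ h]; rewrite gmul1l in h; exact (lt_irrefl _ h).
Qed.
End Order.

(** * Finite connected pieces of a tree *)

Section FiniteSubgraph.
Variables (V : Type) (adj : V -> V -> Prop).
Hypothesis hT : is_tree adj.

(** Both orientations are required: an edge at [v] will be lifted from its end at [v], whether a
    walk leaves [v] or returns to it. *)
Definition edge_in (E : list (V * V)) a b := adj a b /\ In (a, b) E /\ In (b, a) E.

Lemma edge_in_mono E E' a b : incl E E' ->
  clos_refl_trans V (edge_in E) a b -> clos_refl_trans V (edge_in E') a b.
Proof.
intros hi; induction 1 as [a b [h1 [h2 h3]]|a|a b c _ IH1 _ IH2].
- apply rt_step; split; auto.
- apply rt_refl.
- now apply rt_trans with b.
Qed.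

Lemma finite_connecting_walk a b : exists E, clos_refl_trans V (edge_in E) a b.
Proof.
induction (tree_connected _ _ hT a b) as [a b h|a|a b c _ [E1 h1] _ [E2 h2]].
- exists [(a, b); (b, a)]; apply rt_step; split; [exact h|simpl; auto].
- exists []; apply rt_refl.
- exists (E1 ++ E2); apply rt_trans with b.
  + apply edge_in_mono with E1; [apply incl_appl, incl_refl|exact h1].
  + apply edge_in_mono with E2; [apply incl_appr, incl_refl|exact h2].
Qed.

Lemma finite_connected_subgraph v l : exists E, forall u, In u l ->
  clos_refl_trans V (edge_in E) v u.
Proof.
induction l as [|u l [E hE]]; [exists []; easy|].
destruct (finite_connecting_walk v u) as [E' h]; exists (E ++ E'); intros u' [<-|hu].
- apply edge_in_mono with E'; [apply incl_appr, incl_refl|exact h].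
- apply edge_in_mono with E; [apply incl_appl, incl_refl|auto].
Qed.
End FiniteSubgraph.

(** * Separating two branches *)

Section Swamp.
Variables (G : group) (V : Type) (adj : V -> V -> Prop) (act : G -> V -> V).
Local Notation "x ** y" := (gmul G x y) (at level 40, left associativity).
Local Notation inv := (ginv G).
Local Notation one := (gone G).
Local Notation Br := (branch V adj).
Hypothesis hT : is_tree adj.
Hypothesis hA : tree_action G adj act.
Hypothesis hinv : without_inversions G adj act.
Variable v w : V.
Hypothesis hvw : adj v w.
Local Notation actM := (act_mul G V adj act hA).
Local Notation act1 := (act_one G V adj act hA).

Lemma stab_inv g a : act g a = a -> act (inv g) a = a.
Proof. intros e; rewrite <- e at 1; apply (act_inv G V adj act hA). Qed.

Lemma stab_subgroup : is_subgroup G (stab G act v).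
Proof.
unfold stab; split; [apply act1|split].
- intros x y hx hy; now rewrite actM, hy.
- intros x; apply stab_inv.
Qed.

Lemma edge_stab_iff n k : adj v n -> edge_stab G act v n k <-> act k v = v /\ act k n = n.
Proof.
intros h; split; [|now left].
intros [hk|hk]; [exact hk|destruct (hinv k v n h hk)].
Qed.

Lemma edge_stab_subgroup n : adj v n -> is_subgroup G (edge_stab G act v n).
Proof.
intros h; split; [|split].
- rewrite edge_stab_iff by exact h; split; apply act1.
- intros x y; rewrite !edge_stab_iff by exact h; intros [h1 h2] [h3 h4].
  rewrite !actM, h3, h4; auto.
- intros x; rewrite !edge_stab_iff by exact h; intros [h1 h2].
  split; now apply stab_inv.
Qed.

(** With one representative per orbit of the vertex group, an edge at [v] becomes a coset of a
    representative edge group; the orbit of [w] gives the cosets of [H]. *)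
Lemma neighbor_transversal : exists can : V -> Prop,
  can w /\ (forall n, can n -> adj v n) /\
  (forall n n' k, can n -> can n' -> act k v = v -> act k n = n' -> n = n') /\
  (forall b, adj v b -> exists k n, act k v = v /\ can n /\ act k n = b).
Proof.
pose (orb := fun n m => adj v m /\ exists k, act k v = v /\ act k n = m).
(* The choice depends only on the predicate [orb n], so equal orbits get equal representatives; the
   second clause forces [w] in its own orbit. *)
pose (rep := fun n => epsilon (inhabits v) (fun m => orb n m /\ (orb n w -> m = w))).
assert (hrep : forall n, adj v n -> orb n (rep n) /\ (orb n w -> rep n = w)).
{ intros n hn.
  apply (epsilon_spec (inhabits v) (fun m => orb n m /\ (orb n w -> m = w))).
  destruct (classic (orb n w)) as [h|h]; [now exists w|].
  exists n; split; [|easy].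
  split; [exact hn|exists one; now rewrite !act1]. }
assert (heq : forall n n' k, act k v = v -> act k n = n' -> orb n = orb n').
{ intros n n' k hk e; apply functional_extensionality; intros m.
  apply propositional_extensionality; unfold orb; split.
  - intros [h [j [h1 h2]]]; split; [exact h|exists (j ** inv k)].
    rewrite !actM, <- e, (act_inv G V adj act hA), (stab_inv k); auto.
  - intros [h [j [h1 h2]]]; split; [exact h|exists (j ** k)].
    rewrite !actM, e, hk; auto. }
exists (fun n => exists n0, adj v n0 /\ n = rep n0).
split; [|split; [|split]].
- exists w; split; [exact hvw|].
  symmetry; apply (hrep w hvw).
  split; [exact hvw|exists one; now rewrite !act1].
- intros n [n0 [h ->]]; apply (hrep n0 h).
- intros n n' k [n0 [h0 ->]] [n1 [h1 ->]] hk e.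
  assert (e2 : orb n0 = orb n1).
  { destruct (hrep n0 h0) as [[_ [j [hj ej]]] _].
    destruct (hrep n1 h1) as [[_ [j' [hj' ej']]] _].
    rewrite (heq _ _ j hj ej), (heq _ _ j' hj' ej'); exact (heq _ _ k hk e). }
  unfold rep; now rewrite e2.
- intros b hb; destruct (hrep b hb) as [[h [k [hk e]]] _].
  exists (inv k), (rep b); split; [now apply stab_inv|split; [now exists b|]].
  rewrite <- e; apply (act_inv G V adj act hA).
Qed.

Variable can : V -> Prop.
Hypothesis can_w : can w.
Hypothesis can_adj : forall n, can n -> adj v n.
Hypothesis can_unique :
  forall n n' k, can n -> can n' -> act k v = v -> act k n = n' -> n = n'.
Hypothesis can_cover :
  forall b, adj v b -> exists k n, act k v = v /\ can n /\ act k n = b.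

(** Each edge of [E] that starts in the orbit of [v] is the image of a representative edge by some
    [t]; these finitely many [t] produce the traces in the vertex group. *)
Lemma edge_lifts (E : list (V * V)) : exists TL : list (G * V),
  (forall t n, In (t, n) TL -> can n) /\
  forall a b t0, In (a, b) E -> adj a b -> act t0 v = a ->
    exists t n, In (t, n) TL /\ act t v = a /\ act t n = b.
Proof.
induction E as [|[a b] E [TL [h1 h2]]]; [exists []; split; easy|].
destruct (classic (adj a b /\ exists t0, act t0 v = a)) as [[hab [t0 ht]]|hn].
- destruct (can_cover (act (inv t0) b)) as [k [n [hk [hn e]]]].
  { apply (act_adj G V adj act hA (inv t0)) in hab.
    now rewrite <- ht, (act_inv G V adj act hA) in hab. }
  exists ((t0 ** k, n) :: TL); split.
  + intros t n' [h|h]; [congruence|eauto].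
  + intros a' b' t' [h|h] hab' ht'.
    * injection h as <- <-; exists (t0 ** k), n; split; [now left|].
      rewrite !actM, hk, e, ht, (act_inv_r G V adj act hA); auto.
    * destruct (h2 a' b' t' h hab' ht') as [t [m [q1 q2]]].
      exists t, m; split; [now right|exact q2].
- exists TL; split; [exact h1|].
  intros a' b' t' [h|h] hab' ht'; [|now apply h2 with t'].
  injection h as <- <-; destruct hn; split; [exact hab'|now exists t'].
Qed.

Variable P : G -> Prop.
Hypothesis hP : positive_cone G (whole G) P.
Local Notation lt := (cone_lt G P).
Local Notation le := (cone_le G P).

(** * Chains above a level in the vertex group *)

Section Level.
Variable c : G.

(** Equivalently, [h] is [one] or lies in the conjugate cone of the vertex group. *)
Definition above h := act h v = v /\ le c (h ** c).

Definition link (M : list G) x y :=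
  above x /\ above y /\ (In (inv x ** y) M \/ In (inv y ** x) M).

Local Notation chain M := (clos_refl_trans G (link M)).

Lemma chain_mono M M' x y : incl M M' -> chain M x y -> chain M' x y.
Proof.
intros hi; induction 1 as [a b [h1 [h2 [h3|h3]]]|a|a b d _ IH1 _ IH2].
- apply rt_step; split; [|split]; auto.
- apply rt_step; split; [|split]; auto.
- apply rt_refl.
- now apply rt_trans with b.
Qed.

Lemma chain_sym M x y : chain M x y -> chain M y x.
Proof.
induction 1 as [a b [h1 [h2 h3]]|a|a b d _ IH1 _ IH2].
- apply rt_step; split; [|split]; tauto.
- apply rt_refl.
- now apply rt_trans with b.
Qed.

Lemma above_mul h x : above h -> above x -> above (h ** x).
Proof.
intros [h1 h2] [h3 h4]; split; [now rewrite actM, h3|].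
apply (le_trans _ _ hP) with (h ** c); [exact h2|].
rewrite mul_assoc; now apply le_mul.
Qed.

Lemma chain_translate M h x y : above h -> chain M x y -> chain M (h ** x) (h ** y).
Proof.
intros hh; induction 1 as [a b [h1 [h2 h3]]|a|a b d _ IH1 _ IH2].
- apply rt_step; split; [|split]; [now apply above_mul|now apply above_mul|].
  revert h3; gsimpl; auto.
- apply rt_refl.
- now apply rt_trans with (h ** b).
Qed.

Lemma rpath_chain X r M l x :
  (forall g h, dist_le G X r g h -> In (inv g ** h) M) ->
  Forall above (x :: l) -> rpath_tail G X r x l -> chain M x (last (x :: l) x).
Proof.
intros hM; revert x; induction l as [|y l IH]; intros x hf hp; [apply rt_refl|].
rewrite last_cons2; apply rt_trans with y.
- apply rt_step; split; [exact (Forall_inv hf)|].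
  split; [exact (Forall_inv (Forall_inv_tail hf))|left; apply hM, hp].
- apply IH; [exact (Forall_inv_tail hf)|apply hp].
Qed.

(* The points of an edge group above a level form a directed union of translates of its
   positive cone, so they are as coarsely connected as that cone. *)
Lemma prieto_chain_one n : adj v n -> Prieto G (edge_stab G act v n) ->
  exists M, forall k, act k v = v -> act k n = n -> le c (k ** c) -> chain M one k.
Proof.
intros hn [_ [X [_ hX]]].
pose proof (conjugate_cone _ _ hP _ c (edge_stab_subgroup n hn)) as hQ.
destruct (hX _ hQ) as [r hr].
destruct (ball_finite G X r) as [M hM].
assert (above1 : above one) by (split; [apply act1|left; now rewrite gmul1l]).
assert (hcase : forall k, le c (k ** c) -> k = one \/ lt c (k ** c)).
{ intros k [e|h]; [left|now right].
  rewrite <- (gmul1r G k), <- (gmulVr G c), gmulA, <- e; reflexivity. }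
assert (habove : forall k, edge_stab G act v n k /\ lt c (k ** c) -> above k).
{ intros k [h1 h2]; apply edge_stab_iff in h1; [|exact hn].
  split; [apply h1|now right]. }
(* The cone omits [one], so one positive [p] is added to [M] as a bridge to it. If there is no such
   [p], only [one] has to be reached. *)
destruct (classic (exists p, edge_stab G act v n p /\ lt c (p ** c))) as [[p hp]|hno].
- exists (p :: M); intros k h1 h2 h3; destruct (hcase k h3) as [->|h4]; [apply rt_refl|].
  assert (hk : edge_stab G act v n k /\ lt c (k ** c)) by (split; [now left|exact h4]).
  apply rt_trans with p.
  + apply rt_step; split; [exact above1|split; [now apply habove|left; left]].
    now gsimpl.
  + destruct (hr p k hp hk) as [l [[_ hl] [hf e]]]; rewrite <- e.
    apply chain_mono with M; [now apply incl_tl, incl_refl|].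
    apply rpath_chain with X r; [exact hM| |exact hl].
    constructor; [now apply habove|].
    apply Forall_impl with (2 := hf); exact habove.
- exists []; intros k h1 h2 h3; destruct (hcase k h3) as [->|h4]; [apply rt_refl|].
  destruct hno; exists k; split; [now left|exact h4].
Qed.

(** Equal images of [n] mean one coset of the edge group; translating by the lower of the two points
    reduces to a chain from [one]. *)
Lemma prieto_chain (NL : list V) :
  (forall n, adj v n -> Prieto G (edge_stab G act v n)) ->
  exists M, forall n, In n NL -> adj v n -> forall h h', above h -> above h' ->
    act h n = act h' n -> chain M h h'.
Proof.
intros hPr; induction NL as [|n NL [M hM]]; [exists []; easy|].
destruct (classic (adj v n)) as [hn|hn].
- destruct (prieto_chain_one n hn (hPr n hn)) as [M' hM'].
  assert (hone : forall h h', above h -> above h' -> act h n = act h' n ->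
    le (h ** c) (h' ** c) -> chain M' h h').
  { intros h h' a1 a2 e hle.
    rewrite <- (gmul1r G h); rewrite <- (mul_inv_cancel _ h h').
    apply chain_translate; [exact a1|]; apply hM'.
    - destruct a1 as [e1 _], a2 as [e2 _]; rewrite actM, e2; now apply stab_inv.
    - rewrite actM, <- e; apply (act_inv G V adj act hA).
    - apply (le_mul _ _ h); now gsimpl. }
  exists (M ++ M'); intros m [<-|hm] hvm h h' a1 a2 e.
  + apply chain_mono with M'; [apply incl_appr, incl_refl|].
    destruct (le_or_lt _ _ hP (h ** c) (h' ** c)) as [hl|hl]; [now apply hone|].
    apply chain_sym, hone; auto; now right.
  + apply chain_mono with M; [apply incl_appl, incl_refl|]; now apply hM with m.
- exists M; intros m [<-|hm] hvm; [easy|now apply hM].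
Qed.

Lemma chain_rpath X r M x y : gen_set G X (stab G act v) ->
  (forall m, In m (M ++ map inv M) -> stab G act v m ->
    forall g, dist_le G X r g (g ** m)) ->
  above x -> chain M x y -> exists l, rpath G (stab G act v) X r x l /\
    Forall above (x :: l) /\ last (x :: l) x = y.
Proof.
intros hX hM hx hc; apply clos_rt_rt1n in hc.
induction hc as [x|x z y [_ [hz hm]] _ IH].
- exists []; repeat split; auto; constructor; auto; apply hx.
- destruct (IH hz) as [l [[hf ht] [ha e]]]; exists (z :: l); split; [split|split].
  + constructor; [apply hx|exact hf].
  + split; [|exact ht].
    rewrite <- (mul_inv_cancel _ x z); apply hM.
    * apply in_or_app; destruct hm as [hm|hm]; [now left|right].
      replace (inv x ** z) with (inv (inv z ** x)) by now gsimpl.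
      now apply in_map.
    * unfold stab; destruct hx as [h1 _], hz as [h2 _]; rewrite actM, h2.
      now apply stab_inv.
  + constructor; auto.
  + now rewrite last_cons2.
Qed.

(** * Following a path through the branches at [v] *)

Section Bypass.
Variables (z1 z2 : V) (E : list (V * V)) (TL : list (G * V)) (L M : list G).
(** The traces known to be accessible; later, the points chained to the starting coset. *)
Variable C : G -> Prop.
Hypothesis TL_can : forall t n, In (t, n) TL -> can n.
Hypothesis TL_lift : forall a b t0, In (a, b) E -> adj a b -> act t0 v = a ->
  exists t n, In (t, n) TL /\ act t v = a /\ act t n = b.
Hypothesis TL_le : forall t n, In (t, n) TL -> le (inv t) c.
Hypothesis one_le : le one c.
Hypothesis L_walk : forall x, In x L ->
  clos_refl_trans V (edge_in V adj E) v (act x v).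
Local Notation T := (one :: map fst TL).
Hypothesis M_TT : forall t t', In t T -> In t' T -> In (inv t ** t') M.
Hypothesis M_TL : forall t x, In t T -> In x L -> In (inv t ** x) M.
Hypothesis C_start : forall h n, above h -> can n -> act h n = z1 -> C h.
Hypothesis C_edge : forall h h' t n, C h -> above h' -> In (t, n) TL ->
  act h n = act h' n -> C h'.
Hypothesis C_near : forall h h', C h -> above h' -> In (inv h ** h') M -> C h'.
Hypothesis C_above : forall h, C h -> above h.

(** The invariant along the walk: at [v], some trace is in [C]; off [v], the current branch is the
    initial one or is attached at an edge that [C] reaches. *)
Definition reached g a :=
  (a = v /\ exists t, In t T /\ C (g ** t)) \/
  (exists b, Br v b a /\ (b = z1 \/ exists h n, C h /\ can n /\ act h n = b)).

(** Since [c] bounds [inv t], one has [c] at most [g] and [g] at most [g ** t ** c]. *)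
Lemma lift_above g t n : le c g -> In (t, n) TL -> act g (act t v) = v -> above (g ** t).
Proof.
intros hg ht e; split; [now rewrite actM|].
apply (le_trans _ _ hP) with g; [exact hg|].
rewrite <- (gmul1r G g) at 1; rewrite mul_assoc; apply le_mul.
apply (le_mul _ _ (inv t)); rewrite inv_mul_cancel, gmul1r; eauto.
Qed.

Lemma in_T t n : In (t, n) TL -> In t T.
Proof. intros h; right; exact (in_map fst _ _ h). Qed.

(** Leaving [v] changes the trace by an element of [M]. A return uses the base edge of the current
    branch, so the new trace shares an edge-group coset with an old one and [C_edge] applies; for
    the initial branch [C_start] does. *)
Lemma reached_step g a b : le c g -> edge_in V adj E a b ->
  reached g (act g a) -> reached g (act g b).
Proof.
intros hg [hab [hE hE']].
pose proof (act_adj G V adj act hA g a b hab) as hgab.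
assert (hlift : forall p q, act g p = v -> In (p, q) E -> adj p q ->
  exists t n, In (t, n) TL /\ can n /\ above (g ** t) /\ act (g ** t) n = act g q).
{ intros p q e hpq hadj.
  destruct (TL_lift p q (inv g) hpq hadj) as [t [n [h1 [h2 h3]]]].
  { rewrite <- e; apply (act_inv G V adj act hA). }
  exists t, n; split; [exact h1|split; [now apply TL_can with t|]].
  split; [apply lift_above with n; auto; now rewrite h2|now rewrite actM, h3]. }
intros [[e [t [ht hC]]]|[d [hd hC]]].
- right; exists (act g b); rewrite e in hgab; split; [now apply branch_self|right].
  destruct (hlift a b e hE hab) as [t' [n [h1 [h2 [h3 h4]]]]].
  exists (g ** t'), n; split; [|auto].
  apply C_near with (g ** t); auto; gsimpl; apply M_TT; [exact ht|now apply in_T with n].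
- destruct (classic (act g b = v)) as [e|hn].
  + left; split; [exact e|].
    assert (hba : adj b a) by now apply (adj_sym _ _ hT).
    destruct (hlift b a e hE' hba) as [t [n [h1 [h2 [h3 h4]]]]].
    assert (hda : d = act g a).
    { apply (branch_unique _ _ hT v _ _ (act g a)); [exact hd|].
      apply branch_self; rewrite <- e; now apply (act_adj G V adj act hA). }
    exists t; split; [now apply in_T with n|].
    rewrite <- hda in h4; destruct hC as [->|[h [n' [k1 [k2 k3]]]]]; [eauto|].
    assert (en : n' = n).
    { destruct (C_above h k1) as [q1 _], h3 as [q2 _].
      apply (can_unique n' n (inv (g ** t) ** h)); auto.
      - rewrite actM, q1; now apply stab_inv.
      - rewrite actM, k3, <- h4; apply (act_inv G V adj act hA). }
    subst n'; apply C_edge with h t n; auto; congruence.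
  + right; exists d; split; [|exact hC].
    now apply (branch_step _ _ hT) with (act g a).
Qed.

Lemma reached_walk g a b : le c g -> clos_refl_trans V (edge_in V adj E) a b ->
  reached g (act g a) -> reached g (act g b).
Proof.
intros hg; induction 1 as [a b h|a|a b d _ IH1 _ IH2]; auto.
now apply reached_step.
Qed.

Lemma reached_jump g g' : le c g -> le c g' -> In (inv g ** g') L ->
  reached g (act g v) -> reached g' (act g' v).
Proof.
intros hg hg' hL hr.
apply (reached_walk g _ _ hg (L_walk _ hL)) in hr.
rewrite <- actM, mul_inv_cancel in hr.
destruct hr as [[e [t [ht hC]]]|hr]; [left|now right].
(* [one] is included among the lifts so that [g'] itself can be the trace when the path sits at
   [v]. *)
split; [exact e|exists one; split; [now left|rewrite gmul1r]].
apply C_near with (g ** t); [exact hC| |].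
- split; [exact e|].
  apply (le_trans _ _ hP) with g'; [exact hg'|].
  rewrite <- (gmul1r G g') at 1; now apply le_mul.
- rewrite inv_mul, mul_assoc; now apply M_TL.
Qed.

Lemma reached_path X r l g :
  (forall g h, dist_le G X r g h -> In (inv g ** h) L) ->
  Forall (le c) (g :: l) -> rpath_tail G X r g l ->
  Br v z1 (act g v) -> Br v z2 (act (last (g :: l) g) v) ->
  z2 = z1 \/ exists h n, C h /\ can n /\ act h n = z2.
Proof.
intros hL hf hp h1 h2.
assert (hr : reached g (act g v)) by (right; exists z1; auto).
clear h1; revert g hf hp hr h2.
induction l as [|g' l IH]; intros g hf hp hr h2.
- destruct hr as [[e _]|[b [hb hr]]].
  + destruct (branch_neq _ _ hT _ _ _ h2 e).
  + now rewrite (branch_unique _ _ hT _ _ _ _ h2 hb).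
- rewrite last_cons2 in h2; apply (IH g'); [exact (Forall_inv_tail hf)|apply hp| |exact h2].
  apply reached_jump with g; [exact (Forall_inv hf)| |apply hL, hp|exact hr].
  exact (Forall_inv (Forall_inv_tail hf)).
Qed.
End Bypass.

(** Points above the level avoid the negative cone, hence every swamp for the conjugate cone, so no
    chain can join the two cosets. *)
Lemma hucha_disconnects_cosets M : Hucha_sub G (stab G act v) (edge_stab G act v w) ->
  exists g1 g2, act g1 v = v /\ act g2 v = v /\ act g1 w <> act g2 w /\
    forall h1 h, above h1 -> act h1 w = act g1 w -> chain M h1 h ->
      act h w <> act g2 w.
Proof.
intros [_ [X [hX hH]]].
destruct (list_bounded_length G X _ (M ++ map inv M) hX) as [r hr].
(* The successor makes the radius positive. *)
destruct (hH _ (conjugate_cone _ _ hP _ c stab_subgroup) _ eq_refl (S r) (Nat.lt_0_succ r))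
  as [S [hS [_ [g1 [g2 [s1 [s2 hd]]]]]]].
assert (key : forall h1 h, above h1 -> act h1 w = act g1 w -> chain M h1 h ->
  act h w <> act g2 w).
{ intros h1 h a1 e1 hc e2.
  destruct (chain_rpath X (Datatypes.S r) M h1 h hX) as [l [hp [hf e]]]; auto.
  { intros m hm hs g; apply dist_le_mono with r; [lia|now apply hr]. }
  assert (hh : above h).
  { rewrite <- e; rewrite Forall_forall in hf; apply hf.
    destruct (exists_last (l := h1 :: l)) as [l' [z ez]]; [easy|].
    rewrite ez, last_last; apply in_or_app; right; now left. }
  assert (hco : forall g x, stab G act v g -> above x -> act x w = act g w ->
    coset G g (edge_stab G act v w) x).
  { intros g x hg [hx _] exw; exists (inv g ** x); split; [left|now gsimpl].
    rewrite !actM, exw, hx, (act_inv G V adj act hA); split; [now apply stab_inv|easy]. }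
  destruct (hd h1 l hp) as [y [hy hSy]].
  - now apply hco.
  - rewrite e; now apply hco.
  - apply hS in hSy as [_ hlt].
    rewrite Forall_forall in hf; destruct (hf y hy) as [_ hle].
    apply (le_not_lt _ _ hP _ _ hle).
    rewrite <- (lt_mul _ _ (inv y)); now gsimpl. }
(* If the cosets coincide, the trivial chain shows that they contain no point above the level. As
   [one] is above it, its coset is a different one. *)
destruct (classic (act g1 w = act g2 w)) as [e|hn].
- assert (hempty : forall h1, above h1 -> act h1 w <> act g1 w).
  { intros h1 a1 e1; apply (key h1 h1 a1 e1 (rt_refl _ _ _)); congruence. }
  exists g1, one; split; [exact s1|split; [apply act1|split]].
  + intros e1; apply (hempty one); [split; [apply act1|left; now rewrite gmul1l]|easy].
  + intros h1 h a1 e1; destruct (hempty h1 a1 e1).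
- exists g1, g2; auto.
Qed.
End Level.

(** The order of choices matters: the radius gives [L], [E] and [TL], these give [c], the level
    gives [M0], and only the final finite set of steps determines the cosets. *)
Lemma separated_branches X r :
  Hucha_sub G (stab G act v) (edge_stab G act v w) ->
  (forall n, adj v n -> Prieto G (edge_stab G act v n)) ->
  exists c g1 g2, act g1 v = v /\ act g2 v = v /\ act g1 w <> act g2 w /\
    forall g l, Forall (le c) (g :: l) -> rpath_tail G X r g l ->
      Br v (act g1 w) (act g v) -> ~ Br v (act g2 w) (act (last (g :: l) g) v).
Proof.
intros hHu hPr.
destruct (ball_finite G X r) as [L hL].
destruct (finite_connected_subgraph _ _ hT v (map (fun x => act x v) L)) as [E hE].
destruct (edge_lifts E) as [TL [TL_can TL_lift]].
destruct (list_upper_bound _ _ hP (one :: map (fun p => inv (fst p)) TL)) as [c hc].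
destruct (prieto_chain c (map snd TL) hPr) as [M0 hM0].
pose (T := one :: map fst TL).
pose (M1 := flat_map (fun t => map (gmul G (inv t)) (T ++ L)) T).
assert (hM1 : forall t x, In t T -> In x T \/ In x L -> In (inv t ** x) M1).
{ intros t x ht hx; apply in_flat_map; exists t; split; [exact ht|].
  apply in_map, in_or_app; exact hx. }
clearbody M1.
destruct (hucha_disconnects_cosets c (M0 ++ M1) hHu) as [g1 [g2 [s1 [s2 [hne hdis]]]]].
exists c, g1, g2; split; [exact s1|split; [exact s2|split; [exact hne|]]].
intros g l hf hp hb1 hb2.
(* These are the chain components that meet the coset of [g1]; by [hdis] they miss that of [g2]. *)
pose (C := fun h => exists h1, above c h1 /\ act h1 w = act g1 w /\
  above c h /\ clos_refl_trans G (link c (M0 ++ M1)) h1 h).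
assert (Cext : forall h h', C h -> above c h' ->
  clos_refl_trans G (link c (M0 ++ M1)) h h' -> C h').
{ intros h h' [h1 [a1 [e1 [_ k]]]] a' k'; exists h1; split; [exact a1|split; [exact e1|]].
  split; [exact a'|now apply rt_trans with h]. }
assert (canw : forall h n g0, act h v = v -> act g0 v = v -> can n ->
  act h n = act g0 w -> n = w).
{ intros h n g0 e e0 hn ew; apply (can_unique n w (inv g0 ** h)); auto.
  - rewrite actM, e; now apply stab_inv.
  - rewrite actM, ew; apply (act_inv G V adj act hA). }
destruct (reached_path c (act g1 w) (act g2 w) E TL L M1 C) with X r l g
  as [e|[h [n [[h1 [a1 [e1 [a k]]]] [hn e]]]]]; auto.
- intros t n ht; apply hc; right; apply in_map_iff; now exists (t, n).
- apply hc; now left.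
- intros x hx; apply hE, (in_map (fun x => act x v)), hx.
- intros h n ha hn e; rewrite (canw h n g1) in e; auto; [|apply ha].
  exists h; repeat split; try apply ha; auto; apply rt_refl.
- intros h h' t n hC ha ht e; apply Cext with h; auto.
  apply chain_mono with M0; [apply incl_appl, incl_refl|].
  apply hM0 with n; auto.
  + exact (in_map snd _ _ ht).
  + apply can_adj, (TL_can t n ht).
  + now destruct hC as [? [_ [_ [? _]]]].
- intros h h' hC ha hM; apply Cext with h; auto.
  apply rt_step; split; [now destruct hC as [? [_ [_ [? _]]]]|split; [exact ha|]].
  left; apply in_or_app; now right.
- intros h [? [_ [_ [ha _]]]]; exact ha.
- rewrite (canw h n g2) in e; auto; [|apply a].
  exact (hdis h1 h a1 e1 k e).
Qed.
End Swamp.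

(** * Swamps for elliptic and cyclic subgroups *)

Section Consequences.
Variables (G : group) (V : Type) (adj : V -> V -> Prop) (act : G -> V -> V).
Local Notation "x ** y" := (gmul G x y) (at level 40, left associativity).
Local Notation inv := (ginv G).
Local Notation one := (gone G).
Local Notation Br := (branch V adj).
Hypothesis hT : is_tree adj.
Hypothesis hA : tree_action G adj act.
Variables v w : V.
Hypothesis hvw : adj v w.
Variable flip : G.
Hypothesis hflip : forall u, ~ Br v w u -> Br v w (act flip u).
Local Notation actM := (act_mul G V adj act hA).

(** One of [a] and [flip ** a] takes [v] into the branch, so a bound there would bound the whole
    group by some [m]; but [m ** p] exceeds [m] for positive [p]. *)
Lemma branch_unbounded P c : positive_cone G (whole G) P ->
  (exists s, s <> one) -> exists a, Br v w (act a v) /\ cone_lt G P c a.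
Proof.
intros hP [s hs]; apply NNPP; intros hn.
assert (hb : forall a, Br v w (act a v) -> cone_le G P a c).
{ intros a ha; destruct (le_or_lt _ _ hP a c) as [h|h]; [exact h|].
  destruct hn; now exists a. }
destruct (list_upper_bound _ _ hP [c; inv flip ** c]) as [m hm].
assert (hall : forall a, cone_le G P a m).
{ intros a; destruct (classic (Br v w (act a v))) as [h|h].
  - apply (le_trans _ _ hP) with c; [now apply hb|apply hm; now left].
  - apply (le_trans _ _ hP) with (inv flip ** c); [|apply hm; right; now left].
    apply (le_mul _ _ flip); rewrite mul_inv_cancel.
    apply hb; rewrite actM; now apply hflip. }
assert (hp : exists p, P p).
{ destruct (proj1 (proj2 (proj2 hP)) s I) as [h|[h|h]]; [now exists s|now exists (inv s)|easy]. }
destruct hp as [p hp]; apply (le_not_lt _ _ hP _ _ (hall (m ** p))).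
unfold cone_lt; now rewrite inv_mul_cancel.
Qed.

Lemma off_branch_stable s u : act s v = v -> act s w <> w ->
  Br v w u -> ~ Br v w (act s u).
Proof.
intros hs hw hu h; apply hw.
apply (act_branch G V adj act hA s) in hu; rewrite hs in hu.
exact (branch_unique _ _ hT _ _ _ _ hu h).
Qed.

(** The map [f] pushes the branch strictly into itself. One application of [f] for each edge from
    the fixed vertex [u] to [v] carries the whole orbit of [v] into the branch. *)
Lemma elliptic_into_branch s L : act s v = v -> act s w <> w ->
  elliptic G act L -> exists k, forall x, L x -> Br v w (act (k ** x) v).
Proof.
intros hs hsw [u hu].
pose (f := flip ** s).
assert (hf : forall a, Br v w a -> Br v w (act f a)).
{ intros a ha; unfold f; rewrite actM; apply hflip; now apply off_branch_stable. }
assert (hfv : Br v w (act f v)).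
{ unfold f; rewrite actM, hs; apply hflip; intros h; now apply (branch_neq _ _ hT _ _ _ h). }
(* An edge leaving the pushed branch can only end at [act f v], which is still in the original
   branch. *)
assert (hdeep : forall a b, Br v w a -> adj (act f a) b -> Br v w b).
{ intros a b ha hab; apply NNPP; intros hb.
  assert (hb' : ~ Br (act f v) (act f w) b).
  { rewrite (act_branch_inv G V adj act hA); intros h; apply hb.
    rewrite <- (act_inv_r G V adj act hA f b); now apply hf. }
  apply (act_branch G V adj act hA f) in ha.
  apply (adj_sym _ _ hT) in hab.
  destruct (branch_crossing _ _ hT _ _ _ _ hab ha hb') as [-> _]; auto. }
assert (hu0 : exists k, Br v w (act k u)).
{ destruct (classic (Br v w u)) as [h|h].
  - exists one; now rewrite (act_one G V adj act hA).
  - exists flip; now apply hflip. }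
destruct hu0 as [k0 hk0].
assert (hbr : forall b, clos_refl_trans V adj u b ->
  exists k, forall x, act x u = u -> Br v w (act (k ** x) b)).
{ intros b hb; apply clos_rt_rtn1 in hb; induction hb as [|b b' hbb _ [k IH]].
  - exists k0; intros x hx; now rewrite actM, hx.
  - exists (f ** k); intros x hx; apply (hdeep (act (k ** x) b)); [now apply IH|].
    rewrite <- actM, <- mul_assoc; now apply (act_adj G V adj act hA). }
destruct (hbr v (tree_connected _ _ hT u v)) as [k hk].
exists k; intros x hx; apply hk, hu, hx.
Qed.

Section Separated.
Variable P : G -> Prop.
Hypothesis hP : positive_cone G (whole G) P.
Variables (X : list G) (r : nat) (c g1 g2 : G).
Hypotheses (s1 : act g1 v = v) (s2 : act g2 v = v).
Hypothesis hne : act g1 w <> act g2 w.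
Hypothesis hsep : forall g l, Forall (cone_le G P c) (g :: l) -> rpath_tail G X r g l ->
  Br v (act g1 w) (act g v) -> ~ Br v (act g2 w) (act (last (g :: l) g) v).

(** Left translation by [c] turns a path of nonnegative points into one of points at least [c], to
    which [hsep] applies. *)
Lemma cone_disconnects (A B : G -> Prop) :
  (forall x, A x -> Br v w (act (inv g1 ** c ** x) v)) ->
  (forall x, B x -> Br v w (act (inv g2 ** c ** x) v)) ->
  r_disconnects G (whole G) X r (fun s => P (inv s)) A B.
Proof.
intros hAx hBx x l [_ hp] hx hl; apply NNPP; intros hn.
assert (hbr : forall g y, act g v = v -> Br v w (act (inv g ** c ** y) v) ->
  Br v (act g w) (act (c ** y) v)).
{ intros g y hg h; apply (act_branch G V adj act hA g) in h; rewrite hg in h.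
  revert h; rewrite <- actM; now gsimpl. }
apply (hsep (c ** x) (map (gmul G c) l)).
- change (Forall (cone_le G P c) (map (gmul G c) (x :: l))).
  apply Forall_forall; intros y hy; apply in_map_iff in hy as [y' [<- hy]].
  rewrite <- (gmul1r G c) at 1; apply le_mul.
  destruct (le_or_lt _ _ hP one y') as [h|h]; [exact h|destruct hn].
  exists y'; split; [exact hy|revert h; unfold cone_lt; now rewrite gmul1r].
- now apply rpath_tail_translate.
- now apply hbr, hAx.
- change (c ** x :: map (gmul G c) l) with (map (gmul G c) (x :: l)).
  rewrite (last_map _ _ _ _ x); apply hbr; [exact s2|]; now apply hBx.
Qed.

Lemma nontrivial_of_separated : exists s, s <> one.
Proof.
apply NNPP; intros hn; apply hne.
assert (h : forall s, s = one) by (intros s; apply NNPP; intros hs; apply hn; now exists s).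
now rewrite (h g1), (h g2).
Qed.

Lemma positive_in_branch g : exists u, P u /\ Br v w (act (inv g ** c ** u) v).
Proof.
destruct (branch_unbounded P (inv g ** c) hP nontrivial_of_separated) as [a [ha hca]].
exists (inv c ** g ** a); split; [|now gsimpl].
revert hca; unfold cone_lt; now gsimpl.
Qed.

Lemma cone_disconnected : exists u1 u2, P u1 /\ P u2 /\
  r_disconnects G (whole G) X r (fun s => P (inv s)) (eq u1) (eq u2).
Proof.
destruct (positive_in_branch g1) as [u1 [p1 b1]].
destruct (positive_in_branch g2) as [u2 [p2 b2]].
exists u1, u2; split; [exact p1|split; [exact p2|]].
apply cone_disconnects; now intros x <-.
Qed.

(** The element [inv g1 ** g2] fixes [v] and moves [w], so some [k] pushes the orbit into the
    branch; after translation by [c], the two cosets land in the branches at [act g1 w] and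
    [act g2 w]. *)
Lemma elliptic_cosets_disconnected L : elliptic G act L -> exists k1 k2,
  r_disconnects G (whole G) X r (fun s => P (inv s)) (coset G k1 L) (coset G k2 L).
Proof.
intros hL.
destruct (elliptic_into_branch (inv g1 ** g2) L) as [k hk]; [| |exact hL|].
- rewrite actM, s2; rewrite <- s1 at 1; apply (act_inv G V adj act hA).
- intros e; apply hne; rewrite <- e at 1; rewrite <- actM; now gsimpl.
- exists (inv c ** g1 ** k), (inv c ** g2 ** k).
  apply cone_disconnects; intros x [y [hy ->]]; specialize (hk y hy); now gsimpl.
Qed.
End Separated.
End Consequences.

(** * Concatenating paths that avoid a set *)

Section Paths.
Variable G : group.
Local Notation "x ** y" := (gmul G x y) (at level 40, left associativity).
Local Notation inv := (ginv G).
Local Notation one := (gone G).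

Lemma r_disconnects_mono K X r r' S A B : r <= r' ->
  r_disconnects G K X r' S A B -> r_disconnects G K X r S A B.
Proof.
intros hr h x l [hf hp]; apply h; split; [exact hf|].
now apply rpath_tail_mono with r.
Qed.

Definition joined X r S a b := exists l, rpath_tail G X r a l /\
  Forall (fun y => ~ S y) (a :: l) /\ last (a :: l) a = b.

Lemma joined_trans X r S a b d : joined X r S a b -> joined X r S b d -> joined X r S a d.
Proof.
intros [l [hp [hf e]]]; revert a hp hf e; induction l as [|a' l IH]; intros a hp hf e h.
- simpl in e; now subst.
- rewrite last_cons2 in e.
  destruct (IH a' (proj2 hp) (Forall_inv_tail hf) e h) as [l' [h1 [h2 h3]]].
  exists (a' :: l'); split; [split; [apply hp|exact h1]|].
  split; [constructor; [exact (Forall_inv hf)|exact h2]|now rewrite last_cons2].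
Qed.

Lemma joined_step X r S a b :
  dist_le G X r a b -> ~ S a -> ~ S b -> joined X r S a b.
Proof. intros h ha hb; exists [b]; repeat split; auto. Qed.

Lemma r_disconnects_joined X r S A B : r_disconnects G (whole G) X r S A B <->
  forall a b, A a -> B b -> ~ joined X r S a b.
Proof.
split.
- intros h a b ha hb [l [hp [hf <-]]].
  destruct (h a l) as [y [hy hS]]; auto.
  + split; [apply Forall_forall; intros; exact I|exact hp].
  + rewrite Forall_forall in hf; exact (hf y hy hS).
- intros h a l [_ hp] ha hb; apply NNPP; intros hn.
  apply (h a _ ha hb); exists l; split; [exact hp|split; [|easy]].
  apply Forall_forall; intros y hy hS; apply hn; now exists y.
Qed.
End Paths.

(** * Cosets of cyclic subgroups *)

Section Cyclic.
Variable G : group.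
Local Notation "x ** y" := (gmul G x y) (at level 40, left associativity).
Local Notation inv := (ginv G).
Local Notation one := (gone G).
Variable P : G -> Prop.
Hypothesis hP : positive_cone G (whole G) P.
Variables (X : list G) (r : nat) (h : G).
Hypothesis hr : forall g, dist_le G X r g (g ** h).
Hypothesis hr' : forall g, dist_le G X r g (g ** inv h).
Hypothesis hh : cone_le G P one h.
Local Notation S := (fun s => P (inv s)).

Lemma not_negative_iff x : ~ P (inv x) <-> cone_le G P one x.
Proof.
replace (P (inv x)) with (cone_lt G P x one) by (unfold cone_lt; now rewrite gmul1r).
split; [|now apply le_not_lt].
intros hx; destruct (le_or_lt _ _ hP one x); tauto.
Qed.

(** Multiplying a nonnegative point on the right by [h] keeps it nonnegative, so the successive
    powers form the path in both directions. *)
Lemma joined_powers u n : cone_le G P one u ->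
  joined G X r S u (u ** gpow_nat G h n) /\ joined G X r S (u ** gpow_nat G h n) u.
Proof.
revert u; induction n as [|n IH]; intros u hu; simpl.
- rewrite gmul1r; split; exists []; repeat constructor; now apply not_negative_iff.
- assert (huh : cone_le G P one (u ** h)).
  { apply (le_trans _ _ hP) with u; [exact hu|].
    rewrite <- (gmul1r G u) at 1; now apply le_mul. }
  rewrite gmulA; destruct (IH (u ** h) huh) as [h1 h2].
  split; apply joined_trans with (u ** h); auto; apply joined_step;
    try (now apply not_negative_iff); [apply hr|].
  replace u with (u ** h ** inv h) at 2 by now gsimpl.
  apply hr'.
Qed.

(* To the right of any nonnegative point the coset is nonnegative and coarsely connected. *)
Lemma joined_in_coset u z : cone_le G P one u -> cone_le G P one (u ** gpowZ G h z) ->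
  joined G X r S u (u ** gpowZ G h z) /\ joined G X r S (u ** gpowZ G h z) u.
Proof.
intros hu hz; destruct z as [|p|p]; simpl in *.
- exact (joined_powers u 0 hu).
- now apply joined_powers.
- destruct (joined_powers _ (Pos.to_nat p) hz) as [h1 h2].
  revert h1 h2; gsimpl; auto.
Qed.

(** The endpoints of a path avoiding the negative cone are nonnegative, hence joined to [u1] and
    [u2] inside their cosets. *)
Lemma cyclic_cosets_disconnected L u1 u2 : P u1 -> P u2 ->
  (forall x, L x <-> exists n, x = gpowZ G h n) ->
  r_disconnects G (whole G) X r S (eq u1) (eq u2) ->
  r_disconnects G (whole G) X r S (coset G u1 L) (coset G u2 L).
Proof.
intros p1 p2 hL hd; rewrite r_disconnects_joined in hd |- *.
intros a b [x [hx ->]] [y [hy ->]] hj.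
apply hL in hx as [m ->]; apply hL in hy as [n ->].
assert (hle : forall u, P u -> cone_le G P one u).
{ intros u hu; right; unfold cone_lt; now rewrite inv_one, gmul1l. }
assert (hends : cone_le G P one (u1 ** gpowZ G h m) /\ cone_le G P one (u2 ** gpowZ G h n)).
{ destruct hj as [l [_ [hf e]]]; split; apply not_negative_iff.
  - exact (Forall_inv hf).
  - rewrite Forall_forall in hf; rewrite <- e; apply hf.
    destruct (exists_last (l := u1 ** gpowZ G h m :: l)) as [l' [z ez]]; [easy|].
    rewrite ez, last_last; apply in_or_app; right; now left. }
destruct hends as [e1 e2].
apply (hd u1 u2 eq_refl eq_refl).
apply joined_trans with (u1 ** gpowZ G h m); [apply joined_in_coset; auto|].
apply joined_trans with (u2 ** gpowZ G h n); [exact hj|].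
apply joined_in_coset; auto.
Qed.
End Cyclic.

Lemma gpowZ_inv (G : group) (g : G) z :
  gpowZ G (ginv G g) z = gpowZ G g (- z).
Proof.
assert (hs : forall n, gmul G g (gpow_nat G g n) = gmul G (gpow_nat G g n) g).
{ induction n as [|n IH]; simpl; [now rewrite gmul1l, gmul1r|].
  rewrite mul_assoc; now rewrite <- IH. }
assert (h : forall n, gpow_nat G (ginv G g) n = ginv G (gpow_nat G g n)).
{ induction n as [|n IH]; simpl; [now rewrite inv_one|].
  now rewrite IH, hs, inv_mul. }
destruct z as [|p|p]; simpl; [easy|apply h|now rewrite h, inv_inv].
Qed.

Lemma cyclic_nonneg_generator (G : group) P (L : G -> Prop) :
  positive_cone G (whole G) P -> cyclic_subgroup G L ->
  exists h, cone_le G P (gone G) h /\ forall x, L x <-> exists n, x = gpowZ G h n.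
Proof.
intros hP [h hL]; destruct (le_or_lt _ _ hP (gone G) h) as [hh|hh]; [now exists h|].
exists (ginv G h); split.
- right; apply (lt_mul _ _ h); now rewrite gmulVr, gmul1r.
- intros x; rewrite hL; split; intros [n ->]; exists (- n)%Z; rewrite gpowZ_inv; [|easy].
  now rewrite Z.opp_involutive.
Qed.

Theorem theorem5p12 (G : group) (V : Type) (adj : V -> V -> Prop) (act : G -> V -> V)
  (hT : is_tree adj) (hA : tree_action G adj act)
  (hinv : without_inversions G adj act)
  (hfg : fin_gen G (whole G)) (hlo : left_orderable G (whole G))
  (hcof : cofinite G adj act) (hmin : minimal_action G adj act)
  (hgen : general_type G adj act)
  (hstab : forall u : V, fin_gen G (stab G act u))
  (v : V) (H : G -> Prop)
  (hH : exists w, adj v w /\ H = edge_stab G act v w)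
  (hHucha : Hucha_sub G (stab G act v) H)
  (hPrieto : forall w, adj v w -> Prieto G (edge_stab G act v w)) :
  Hucha G (whole G)
    (fun L => cyclic_subgroup G L \/ (is_subgroup G L /\ elliptic G act L)).
Proof.
destruct hH as [w [hvw ->]]; destruct hfg as [X hX].
split; [exact hlo|exists X; split; [exact hX|]].
intros P hP L hL r _; exists (fun s => P (ginv G s)).
destruct (exists_flip G V adj act hT hA v w hvw hmin (proj1 (proj2 hgen))) as [flip hflip].
destruct (neighbor_transversal G V adj act hA v w hvw) as [can [c1 [c2 [c3 c4]]]].
assert (hsep : forall r', exists c g1 g2,
  act g1 v = v /\ act g2 v = v /\ act g1 w <> act g2 w /\
  forall g l, Forall (cone_le G P c) (g :: l) -> rpath_tail G X r' g l ->
    branch V adj v (act g1 w) (act g v) ->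
    ~ branch V adj v (act g2 w) (act (last (g :: l) g) v)).
{ intros r'; now apply (separated_branches G V adj act hT hA hinv v w) with can. }
split; [easy|].
destruct hL as [hL|[_ hL]].
- destruct (cyclic_nonneg_generator G P L hP hL) as [h [hh hLh]].
  destruct (list_bounded_length G X (whole G) [h; ginv G h] hX) as [k hk].
  (* The larger radius admits both the steps of length [r] and the steps by [h] and its inverse,
     bounded by [k]. *)
  destruct (hsep (r + k)) as [c [g1 [g2 [s1 [s2 [hne hs]]]]]].
  destruct (cone_disconnected G V adj act hA v w flip hflip P hP X _ c g1 g2 s1 s2 hne hs)
    as [u1 [u2 [p1 [p2 hd]]]].
  split.
  + exists u1, u2; split; [exact p1|split; [exact p2|]].
    apply r_disconnects_mono with (r + k); [lia|exact hd].
  + exists u1, u2; split; [exact I|split; [exact I|]].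
    apply r_disconnects_mono with (r + k); [lia|].
    apply cyclic_cosets_disconnected with h; auto;
      intros g; apply dist_le_mono with k; try lia; apply hk; simpl; auto; exact I.
- destruct (hsep r) as [c [g1 [g2 [s1 [s2 [hne hs]]]]]].
  split.
  + destruct (cone_disconnected G V adj act hA v w flip hflip P hP X _ c g1 g2 s1 s2 hne hs)
      as [u1 [u2 h]]; now exists u1, u2.
  + destruct (elliptic_cosets_disconnected G V adj act hT hA v w flip hflip P hP X
      _ c g1 g2 s1 s2 hne hs L hL) as [k1 [k2 h]].
    exists k1, k2; split; [exact I|split; [exact I|exact h]].
Qed.
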